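(* Let $k$ be an algebraically closed field of characteristic zero, let $c \geq 2$, and let $X_c \subseteq \mathbb{A}^{rs}$ be the variety of $r \times s$ matrices over $k$ of rank at most $c$. Suppose $r, s \geq c+2$ and $r+s \geq 2c+6$. Then the second jet scheme $\mathcal{J}_2(X_c)$ is reducible (i.e. not irreducible).
   Context: $X_c$ is the closed subscheme of $\mathbb{A}^{rs} = \operatorname{Spec} k[x_{ij} : 1\le i\le r, 1\le j\le s]$ defined by the ideal $I_{c+1}$ generated by all $(c+1)\times(c+1)$ subdeterminants of the generic matrix $(x_{ij})$. For a scheme $X$ of finite type over $k$, the $m$-th jet scheme $\mathcal{J}_m(X)$ is the scheme parametrizing $k$-morphisms $\operatorname{Spec} k[t]/(t^{m+1}) \to X$. Concretely, $\mathcal{J}_m(X_c)$ is the closed subscheme of $\operatorname{Spec} k[x_{ij}^{(l)} : 1\le i\le r, 1\le j\le s, 0\le l\le m]$ defined by the ideal generated by the coefficients of $t^0, t^1, \ldots, t^m$ in all $(c+1)\times(c+1)$ subdeterminants of the matrix with entries $x_{ij}^{(0)} + x_{ij}^{(1)}t + \cdots + x_{ij}^{(m)}t^m$. *)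

(* Defs.v *)
From mathcomp Require Import all_boot all_order all_algebra.
From mathcomp Require Import ring_quotient.
From mathcomp Require Import mpoly.

Set Implicit Arguments.
Unset Strict Implicit.
Unset Printing Implicit Defensive.

Import GRing.Theory.
Local Open Scope ring_scope.

Definition generated_ideal (R : comNzRingType) (E : R -> Prop) (f : R) : Prop :=
  exists (n : nat) (a g : 'I_n -> R),
    (forall i, E (g i)) /\ f = \sum_(i < n) a i * g i.

(* The points of Spec R are the terms of [prime_idealr R], the library's type of
   (proper) prime ideals.  Two terms with the same underlying predicate lie in
   the same closed subsets, so they count as one point topologically.
   [zero_locus I] is the underlying set of the closed subscheme Spec (R / I). *)
Definition zero_locus (R : comNzRingType) (I : R -> Prop)
    (p : prime_idealr R) : Prop :=
  forall f, I f -> f \in (p : {pred R}).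

Definition zariski_closed (R : comNzRingType) (Z : prime_idealr R -> Prop) : Prop :=
  exists E : R -> Prop, forall p, Z p <-> zero_locus E p.

(* Irreducibility for the subspace topology: nonempty, and not the union of
   two proper closed subsets. *)
Definition zariski_irreducible (R : comNzRingType)
    (Y : prime_idealr R -> Prop) : Prop :=
  (exists p, Y p) /\
  forall Z1 Z2 : prime_idealr R -> Prop,
    zariski_closed Z1 -> zariski_closed Z2 ->
    (forall p, Y p -> Z1 p \/ Z2 p) ->
    (forall p, Y p -> Z1 p) \/ (forall p, Y p -> Z2 p).

(* k[x_ij^(l) : i < r, j < s, l <= m] *)
Definition jet_index (r s m : nat) : finType := ('I_r * 'I_s * 'I_m.+1)%type.

Definition jet_ring (k : fieldType) (r s m : nat) : comNzRingType :=
  {mpoly k[#|jet_index r s m|]}.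

Definition jet_var (k : fieldType) (r s m : nat)
    (i : 'I_r) (j : 'I_s) (l : 'I_m.+1) : jet_ring k r s m :=
  'X_(enum_rank ((i, j, l) : jet_index r s m)).

(* The entries are x_ij^(0) + x_ij^(1) t + ... + x_ij^(m) t^m, where t is the
   variable of [{poly jet_ring k r s m}]. *)
Definition jet_matrix (k : fieldType) (r s m : nat) :
    'M[{poly jet_ring k r s m}]_(r, s) :=
  \matrix_(i < r, j < s) \sum_(l < m.+1) (jet_var k i j l)%:P * 'X^l.

Definition increasing (p n : nat) (f : 'I_p -> 'I_n) : Prop :=
  forall a b : 'I_p, (a < b)%N -> (f a < f b)%N.

Definition is_minor (R : comNzRingType) (r s p : nat) (M : 'M[R]_(r, s))
    (d : R) : Prop :=
  exists (f : 'I_p -> 'I_r) (g : 'I_p -> 'I_s),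
    [/\ increasing f, increasing g & d = \det (mxsub f g M)].

Definition determinantal_jet_ideal (k : fieldType) (r s c m : nat) :
    jet_ring k r s m -> Prop :=
  generated_ideal (fun e : jet_ring k r s m =>
    exists (d : {poly jet_ring k r s m}) (l : nat),
      [/\ is_minor c.+1 (jet_matrix k r s m) d, (l <= m)%N & e = d`_l]).

(* The underlying set, in the spectrum of [jet_ring k r s m], of the m-th jet
   scheme of the variety X_c of r x s matrices of rank at most c. *)
Definition determinantal_jet_scheme (k : fieldType) (r s c m : nat) :
    prime_idealr (jet_ring k r s m) -> Prop :=
  zero_locus (@determinantal_jet_ideal k r s c m).

(* Main.v *)
Require Import Defs.
From HB Require Import structures.
From mathcomp Require Import all_boot all_order all_algebra.
From mathcomp Require Import generic_quotient ring_quotient mpoly.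
From mathcomp Require Import ring zify.

(** Write a 2-jet of matrices as N(t) = A + B t + C t^2 and put c = d + 1.
    Let D(t) be the minor of N on the first c rows and columns, and let
    mu_ij(t) be the c x c minor on rows 0, ..., d-1, i and columns
    0, ..., d-1, j.

    Suppose that the (c+1)-minors of N vanish modulo t^3.  Expanding them along
    a column shows that D N = U V modulo t^3, where U has c columns
    ([rank_factorization]); determinants being multiplicative,
    D^c mu_ij = w_i v_j modulo t^3 ([bordered_rank_one]).  So, where D(0) does
    not vanish, (mu_ij) is a jet of matrices of rank one.  Each of its
    coefficient rows in degrees 0, 1, 2 is then a combination of the three rows
    formed by the degree 0, 1 and 2 coefficients of v, whence every 4 x 4 minor
    F of the stack of these coefficient rows vanishes there
    ([stacked_jets_det]).  Thus F D(0) vanishes on the whole jet scheme.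

    Neither factor does.  D(0) is 1 at the constant jet diag(1, ..., 1, 0, ...)
    of rank c.  For F, keep 1 in the first d diagonal places, but let the next
    rows be multiples of t, t^2, t^2, ...: then a (c+1)-minor, which involves at
    least two of these rows, is divisible by t^3 whatever the other factors of
    these rows are.  This freedom makes the four stacked rows the four unit
    vectors, so that F = 1 ([order2_point]).  This needs d + 3 rows and d + 4
    columns; as r + s >= 2 c + 6, it is available after a transposition if
    necessary.

    A point of the spectrum is a prime ideal p.  Congruences modulo t^3 and p
    are handled by the ideal [jet_ideal p 2] of R[t], and the two jets above
    become points as kernels of evaluation morphisms. *)

Set Implicit Arguments.
Unset Strict Implicit.
Unset Printing Implicit Defensive.
Import GRing.Theory.
Local Open Scope ring_scope.

(** * Ideals and residues *)

Section Kernel.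
Variables (R : comNzRingType) (K : idomainType) (phi : {rmorphism R -> K}).
Definition kernel : R -> bool := fun x => phi x == 0.

Lemma kernel_idealr : idealr_closed kernel.
Proof.
split=> [||a x y]; rewrite /in_mem /= /kernel ?rmorph0 ?rmorph1 ?oner_eq0 //.
by move=> /eqP x0 /eqP y0; rewrite rmorphD rmorphM x0 y0 mulr0 addr0.
Qed.
HB.instance Definition _ := isIdealr.Build R kernel kernel_idealr.

Lemma kernel_prime : prime_idealr_closed kernel.
Proof. by move=> x y; rewrite /in_mem /= /kernel rmorphM mulf_eq0. Qed.
HB.instance Definition _ := isPrimeIdealrClosed.Build R kernel kernel_prime.
End Kernel.

Section JetIdeal.
Variables (R : comNzRingType) (p : idealr R).

(** The kernel of R[t] -> (R/p)[t] / (t^(m+1)): being an ideal of R[t] lets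
    determinants be compared modulo t^(m+1) and p by a single quotient. *)
Definition jet_ideal (m : nat) : {poly R} -> bool :=
  fun x => [forall l : 'I_m.+1, x`_l \in p].

Lemma jet_idealP m (x : {poly R}) :
  reflect (forall l, (l <= m)%N -> x`_l \in p) (x \in jet_ideal m).
Proof.
apply: (iffP forallP) => [h l hl|h l]; last by apply: h; rewrite -ltnS.
exact: (h (Ordinal (hl : (l < m.+1)%N))).
Qed.

Lemma jet_ideal_closed m : idealr_closed (jet_ideal m).
Proof.
split.
- by apply/jet_idealP => l _; rewrite coef0 rpred0.
- by apply/negP=> /jet_idealP/(_ 0 isT); rewrite coef1 idealr1.
move=> a x y /jet_idealP hx /jet_idealP hy; apply/jet_idealP => l hl.
rewrite coefD rpredD ?hy // coefM rpred_sum // => i _.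
by rewrite idealMr // hx //; lia.
Qed.
HB.instance Definition _ m :=
  isIdealr.Build {poly R} (jet_ideal m) (jet_ideal_closed m).
End JetIdeal.

Section Residue.
Variables (R : comNzRingType) (I : idealr R).
Definition residue : {rmorphism R -> {ideal_quot I}} := \pi_({ideal_quot I})%qT.

Lemma residue_eq x y : (residue x == residue y) = (x - y \in I).
Proof. by rewrite Quotient.idealrBE. Qed.

Lemma residue_eq0 x : (residue x == 0) = (x \in I).
Proof. by rewrite -(rmorph0 residue) residue_eq subr0. Qed.

Lemma mod_idealP x y : reflect (residue x = residue y) (x - y \in I).
Proof. by rewrite -residue_eq; apply: eqP. Qed.
End Residue.

(** * Minors *)

Lemma det_mul_thin (R : comNzRingType) n
    (W : 'M[R]_(n.+1, n)) (V : 'M[R]_(n, n.+1)) :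
  \det (W *m V) = 0.
Proof.
have -> : W *m V = row_mx (0 : 'M_(n.+1, 1)) W *m col_mx (0 : 'M_(1, n.+1)) V.
  by rewrite mul_row_col mul0mx add0r.
rewrite (@det_mulmx _ n.+1) (expand_det_col _ 0) big1 ?mul0r // => i _.
rewrite (_ : (0 : 'I_n.+1) = lshift n (0 : 'I_1)); last exact: val_inj.
by rewrite (@row_mxEl _ n.+1 1 n) mxE mul0r.
Qed.

Lemma det_mxsub_diag_mul (R : comNzRingType) r s n (D : 'rV[R]_r) (E : 'M[R]_(r, s))
    (f : 'I_n -> 'I_r) (g : 'I_n -> 'I_s) :
  \det (mxsub f g (diag_mx D *m E)) = (\prod_a D 0 (f a)) * \det (mxsub f g E).
Proof.
rewrite (_ : mxsub f g _ = diag_mx (\row_a D 0 (f a)) *m mxsub f g E).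
  by rewrite det_mulmx det_diag; under eq_bigr do rewrite mxE.
by rewrite !mul_diag_mx; apply/matrixP=> a b; rewrite !mxE.
Qed.

(** The selection 0, ..., n-1, i of n + 1 indices.  The value i < n is allowed and
    repeats an index, so that the minors bordering the leading block are defined
    for all i and j; the degenerate ones are zero. *)
Definition border n r (h : (n <= r)%N) (i : 'I_r) (a : 'I_n.+1) : 'I_r :=
  if unlift ord_max a is Some b then widen_ord h b else i.

Lemma val_border n r (h : (n <= r)%N) (i : 'I_r) (a : 'I_n.+1) :
  border h i a = (if (a < n)%N then a : nat else i) :> nat.
Proof.
rewrite /border; case: unliftP => [b ->|->]; last by rewrite ltnn.
by rewrite lift_max ltn_ord.
Qed.

Lemma border_max n r (h : (n <= r)%N) (i : 'I_r) : border h i ord_max = i.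
Proof. by rewrite /border unlift_none. Qed.

Lemma border_lift n r (h : (n <= r)%N) (i : 'I_r) b :
  border h i (lift ord_max b) = widen_ord h b.
Proof. by rewrite /border liftK. Qed.

Lemma border_increasing n r (h : (n <= r)%N) (i : 'I_r) :
  (n <= i)%N -> increasing (border h i).
Proof.
move=> ni a b ab; rewrite !val_border; have := ltn_ord b.
by case: ifP; case: ifP; lia.
Qed.

Lemma border_repeat n r (h : (n <= r)%N) (i : 'I_r) : (i < n)%N ->
  exists2 a : 'I_n.+1, a != ord_max & border h i a = border h i ord_max.
Proof.
move=> lin; exists (lift ord_max (Ordinal lin)).
  by rewrite eq_sym neq_lift.
by rewrite border_lift border_max; apply: val_inj.
Qed.

Lemma det_mxsub_row_repeat (R : comNzRingType) r s n (A : 'M[R]_(r, s))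
    (f : 'I_n -> 'I_r) (g : 'I_n -> 'I_s) a b :
  a != b -> f a = f b -> \det (mxsub f g A) = 0.
Proof.
by move=> ab fab; apply: (determinant_alternate ab) => j; rewrite !mxE fab.
Qed.

Lemma det_mxsub_tr (R : comNzRingType) r s n (A : 'M[R]_(r, s))
    (f : 'I_n -> 'I_r) (g : 'I_n -> 'I_s) :
  \det (mxsub g f A^T) = \det (mxsub f g A).
Proof. by rewrite -det_tr; congr (\det _); apply/matrixP=> a b; rewrite !mxE. Qed.

Lemma bordered_minors (R : comNzRingType) (I : idealr R) r s n (A : 'M[R]_(r, s))
    (hr : (n <= r)%N) (hs : (n <= s)%N) :
  (forall f g, increasing f -> increasing g ->
    \det (mxsub (f : 'I_n.+1 -> _) g A) \in I) ->
  forall i j, \det (mxsub (border hr i) (border hs j) A) \in I.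
Proof.
move=> minA i j; have [/(border_repeat hr)[a na ea]|ni] := ltnP i n.
  by rewrite (det_mxsub_row_repeat _ _ na ea) rpred0.
have [/(border_repeat hs)[a na ea]|nj] := ltnP j n.
  by rewrite -det_mxsub_tr (det_mxsub_row_repeat _ _ na ea) rpred0.
by apply: minA; apply: border_increasing.
Qed.

(** Cramer's rule without division: expanding the bordered minor of (i, j) along
    its last column expresses D A_ij through the first n entries of column j,
    with coefficients that depend on i only; these coefficients form U. *)
Lemma rank_factorization (R : comNzRingType) r s n (A : 'M[R]_(r, s))
    (hr : (n <= r)%N) (hs : (n <= s)%N) :
  (forall i j, \det (mxsub (border hr i) (border hs j) A) = 0) ->
  exists U : 'M[R]_(r, n),
    \det (mxsub (widen_ord hr) (widen_ord hs) A) *: A =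
    U *m rowsub (widen_ord hr) A.
Proof.
move=> minA.
(* These cofactors do not see the last column of the bordered submatrix, so it is
   replaced by 0 to remove the dependence on j. *)
pose B i := \matrix_(a, b < n.+1)
  if unlift ord_max b is Some b' then A (border hr i a) (widen_ord hs b') else 0.
have cofB i j a : cofactor (mxsub (border hr i) (border hs j) A) a ord_max =
                  cofactor (B i) a ord_max.
  congr (_ * \det _); apply/matrixP=> x y; rewrite !mxE.
  by rewrite border_lift liftK.
have cofBmax i : cofactor (B i) ord_max ord_max =
                 \det (mxsub (widen_ord hr) (widen_ord hs) A).
  rewrite /cofactor addnn -signr_odd odd_double mul1r; congr (\det _).
  by apply/matrixP=> a b; rewrite !mxE liftK border_lift.
exists (\matrix_(i, b) - cofactor (B i) (lift ord_max b) ord_max).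
apply/matrixP => i j; rewrite !mxE.
have := minA i j; rewrite (expand_det_col _ ord_max) big_ord_recr /= => /eqP.
rewrite mxE !border_max cofB cofBmax addrC addr_eq0 mulrC => /eqP ->.
rewrite -sumrN; apply: eq_bigr => b _.
have -> : widen_ord (leqnSn n) b = lift ord_max b.
  by apply: val_inj; rewrite /= /bump leqNgt ltn_ord.
by rewrite cofB !mxE border_lift border_max mulNr mulrC.
Qed.

(** By [rank_factorization], the rows and columns selected for a bordered minor of
    order d + 1 factor through square matrices of that same order, one depending
    on i and the other on j. *)
Lemma bordered_rank_one (R : comNzRingType) r s d (A : 'M[R]_(r, s))
    (hr : (d.+1 <= r)%N) (hs : (d.+1 <= s)%N) :
  (forall i j, \det (mxsub (border hr i) (border hs j) A) = 0) ->
  exists (w : 'I_r -> R) (v : 'I_s -> R), forall i j,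
    \det (mxsub (widen_ord hr) (widen_ord hs) A) ^+ d.+1 *
    \det (mxsub (border (ltnW hr) i) (border (ltnW hs) j) A) = w i * v j.
Proof.
case/rank_factorization=> U eU.
exists (fun i => \det (rowsub (border (ltnW hr) i) U)).
exists (fun j => \det (mxsub (widen_ord hr) (border (ltnW hs) j) A)) => i j.
rewrite -detZ -det_mulmx; congr (\det _).
apply/matrixP=> a b; have /matrixP/(_ (border (ltnW hr) i a) (border (ltnW hs) j b)) := eU.
by rewrite !mxE => ->; apply: eq_bigr => x _; rewrite !mxE.
Qed.

Lemma bordered_rank_one_mod (R : comNzRingType) (I : idealr R) r s d
    (A : 'M[R]_(r, s)) (hr : (d.+1 <= r)%N) (hs : (d.+1 <= s)%N) :
  (forall i j, \det (mxsub (border hr i) (border hs j) A) \in I) ->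
  exists (w : 'I_r -> R) (v : 'I_s -> R), forall i j,
    \det (mxsub (widen_ord hr) (widen_ord hs) A) ^+ d.+1 *
    \det (mxsub (border (ltnW hr) i) (border (ltnW hs) j) A) - w i * v j \in I.
Proof.
move=> minA; have [|w [v e]] := @bordered_rank_one _ r s d (map_mx (residue I) A) hr hs.
  by move=> i j; rewrite -map_mxsub det_map_mx; apply/eqP; rewrite residue_eq0.
exists (fun i => repr (w i)), (fun j => repr (v j)) => i j.
rewrite -residue_eq; have /eqP := e i j.
by rewrite -!map_mxsub !det_map_mx !rmorphM rmorphXn /residue /= !reprK.
Qed.

(** * Jets of rank-one matrices *)

(** Where p(0) becomes invertible, p is invertible modulo t^m, by a truncated
    geometric series; the power p(0)^m clears its denominators. *)
Lemma invert_mod_Xn (R : comNzRingType) m (p : {poly R}) :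
  exists b u, p * b = (p`_0 ^+ m)%:P + 'X^m * u.
Proof.
set a := p`_0; set q := drop_poly 1 p.
have -> : p = a%:P - 'X * - q.
  rewrite mulrN opprK; apply/polyP=> l; rewrite coefD coefC coefXM coef_drop_poly.
  by case: l => [|l] /=; rewrite ?addr0 // add0r addn1.
exists (\sum_(i < m) a%:P ^+ (m.-1 - i) * ('X * - q) ^+ i), (- (- q) ^+ m).
by rewrite -subrXX exprMn_comm ?mulrN ?rmorphXn //; apply: mulrC.
Qed.

(** If a power of D times mu is of the form w_i v_j modulo t^(m+1) and p, then D is
    a unit there as soon as D(0) is not in p, so mu itself is of this form.  The
    coefficient of degree l <= m in row i of mu is then a combination of the
    m + 1 coefficient rows of v, and any m + 2 such rows are dependent. *)
Lemma stacked_jets_det (R : comNzRingType) (p : prime_idealr R) m n (I J : Type)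
    (D : {poly R}) (mu : I -> J -> {poly R}) (w : I -> {poly R}) (v : J -> {poly R})
    (iota : 'I_m.+2 -> I) (kappa : 'I_m.+2 -> J) (lev : 'I_m.+2 -> nat) :
  (forall i j, D ^+ n * mu i j - w i * v j \in jet_ideal p m) ->
  (forall a, (lev a <= m)%N) -> D`_0 \notin p ->
  \det (\matrix_(a, b) (mu (iota a) (kappa b))`_(lev a)) \in p.
Proof.
move=> rank1 levm D0.
have [b [u eb]] := invert_mod_Xn m.+1 D.
set al := D`_0 ^+ m.+1 in eb.
have rank1' i j : (al ^+ n)%:P * mu i j - v j * (b ^+ n * w i) \in jet_ideal p m.
  apply/mod_idealP; have /mod_idealP := rank1 i j; set pi := residue _ => e.
  rewrite [(al ^+ n)%:P]rmorphXn rmorphM rmorphXn /=.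
  have <- : pi (D * b) = pi al%:P.
    rewrite eb; apply/mod_idealP; rewrite addrAC subrr add0r; apply/jet_idealP=> l lm.
    by rewrite coefXnM ltnS lm rpred0.
  transitivity (pi (b ^+ n) * pi (D ^+ n * mu i j)).
    by rewrite !rmorphM !rmorphXn exprMn mulrCA mulrA.
  by rewrite e !rmorphM; ring.
set S := \matrix_(a, b) _.
pose W := \matrix_(a < m.+2, q < m.+1)
  if (q <= lev a)%N then (b ^+ n * w (iota a))`_(lev a - q) else 0.
pose V := \matrix_(q < m.+1, a < m.+2) (v (kappa a))`_q.
have eS : map_mx (residue p) ((al ^+ n) *: S) = map_mx (residue p) (W *m V).
  apply/matrixP=> x y; rewrite /S !mxE; apply/mod_idealP.
  have /jet_idealP/(_ _ (levm x)) := rank1' (iota x) (kappa y).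
  rewrite coefB coefCM coefM.
  (* All coefficients are indexed by the same m + 1 degrees of v; those above the
     degree of the coefficient contribute 0. *)
  rewrite (big_ord_widen m.+1 (fun q => (v _)`_q * (b ^+ n * w _)`_(lev x - q))) ?ltnS //.
  rewrite big_mkcond => h; apply: etrans h; congr (in_mem _ _); congr (_ - _).
  by apply: eq_bigr => q _; rewrite !mxE ltnS; case: ifP => _; rewrite ?mul0r // mulrC.
have : \det ((al ^+ n) *: S) \in p.
  by rewrite -residue_eq0 -det_map_mx eS det_map_mx det_mul_thin rmorph0.
have pX x k : x \notin p -> x ^+ k \notin p.
  move=> xp; elim: k => [|k IH]; first by rewrite expr0 idealr1.
  by rewrite exprS prime_idealrM negb_or xp.
by rewrite detZ prime_idealrM (negPf (pX _ _ (pX _ _ (pX _ _ D0)))).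
Qed.

(** * Reducibility from a product that vanishes *)

Lemma reducible_by_product (R : comNzRingType) (Y : prime_idealr R -> Prop) (F G : R)
    (pF pG : prime_idealr R) :
  (forall p, Y p -> G \notin p -> F \in p) ->
  Y pF -> F \notin pF -> Y pG -> G \notin pG -> ~ zariski_irreducible Y.
Proof.
move=> cover YF nF YG nG [_ irr].
pose Z (f : R) (p : prime_idealr R) := f \in p.
have Zclosed f : zariski_closed (Z f).
  by exists (fun e => e = f) => p; split=> [fp _ ->|]; last exact.
have [|ZF|ZG] := irr (Z F) (Z G) (Zclosed _) (Zclosed _).
- by move=> p /cover; rewrite /Z; case: (boolP (G \in p)) => [|_ ->] //; [right|left].
- by have := ZF _ YF; apply/negP.
- by have := ZG _ YG; apply/negP.
Qed.

Definition minors_in_jet_ideal (R : comNzRingType) r s c m (N : 'M[{poly R}]_(r, s))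
    (p : idealr R) : Prop :=
  forall f g, increasing f -> increasing g ->
    \det (mxsub (f : 'I_c.+1 -> 'I_r) (g : 'I_c.+1 -> 'I_s) N) \in jet_ideal p m.

Lemma increasing_ge p n (f : 'I_p -> 'I_n) (a : 'I_p) : increasing f -> (a <= f a)%N.
Proof.
move=> incf; case: a => a; elim: a => [//|a IH] ha.
exact: leq_ltn_trans (IH (ltnW ha)) (incf (Ordinal (ltnW ha)) (Ordinal ha) (ltnSn a)).
Qed.

Section Core.
Variables (R : comNzRingType) (r s d : nat).
Hypotheses (hr : (d.+1 <= r)%N) (hs : (d.+1 <= s)%N).
Implicit Type N : 'M[{poly R}]_(r, s).

Definition principal_minor N := (\det (mxsub (widen_ord hr) (widen_ord hs) N))`_0.

Definition bordered_minor N i j := \det (mxsub (border (ltnW hr) i) (border (ltnW hs) j) N).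

(** The polynomial F.  In its use [iota 0] and [iota 1] are equal, so that one row of
    the jet enters with its coefficients of both degrees 1 and 2, and two further
    rows with those of degree 2. *)
Definition stacked_minors (iota : 'I_4 -> 'I_r) (kappa : 'I_4 -> 'I_s) N :=
  \det (\matrix_(a, b) (bordered_minor N (iota a) (kappa b))`_(a != 0).+1).

Lemma stacked_minors_vanish N (p : prime_idealr R) iota kappa :
  minors_in_jet_ideal d.+1 2 N p -> principal_minor N \notin p ->
  stacked_minors iota kappa N \in p.
Proof.
move=> minN; have [w [v e]] := bordered_rank_one_mod (bordered_minors hr hs minN).
apply: (@stacked_jets_det _ p 2 _ _ _ _ _ _ _ iota kappa (fun a => (a != 0).+1) e) => a.
by case: (a != 0).
Qed.
End Core.

Section Morphism.
Variables (R K : comNzRingType) (phi : {rmorphism R -> K}) (r s d : nat).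
Hypotheses (hr : (d.+1 <= r)%N) (hs : (d.+1 <= s)%N).
Variable N : 'M[{poly R}]_(r, s).
Let N' := map_mx (map_poly phi) N.

Lemma rmorph_principal_minor : phi (principal_minor hr hs N) = principal_minor hr hs N'.
Proof. by rewrite /principal_minor /N' -map_mxsub det_map_mx coef_map. Qed.

Lemma rmorph_stacked_minors iota kappa :
  phi (stacked_minors hr hs iota kappa N) = stacked_minors hr hs iota kappa N'.
Proof.
rewrite /stacked_minors -det_map_mx; congr (\det _); apply/matrixP => a b.
by rewrite !mxE /bordered_minor /N' -map_mxsub det_map_mx coef_map.
Qed.
End Morphism.

Lemma minors_in_kernel (R : comNzRingType) (K : idomainType) (phi : {rmorphism R -> K})
    r s c m (N : 'M[{poly R}]_(r, s)) :
  (forall f g, increasing f -> increasing g ->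
    exists u, \det (mxsub (f : 'I_c.+1 -> 'I_r) (g : 'I_c.+1 -> 'I_s)
      (map_mx (map_poly phi) N)) = 'X^(m.+1) * u) ->
  minors_in_jet_ideal c m N (kernel phi).
Proof.
move=> min0 f g incf incg; apply/jet_idealP => l lm.
have [u e] := min0 f g incf incg; rewrite /in_mem /= /kernel -coef_map -det_map_mx.
by rewrite map_mxsub e coefXnM ltnS lm.
Qed.

(** * Jets at which the two factors are nonzero *)

Section Points.
Variables (K : comNzRingType) (r s d : nat).

Definition constant_point : 'M[{poly K}]_(r, s) :=
  diag_mx (\row_i (i < d.+1)%:R) *m \matrix_(i, j) (i == j :> nat)%:R.

(** Rows d, d+1, d+2 are t e_d + t^2 e_(d+1), t^2 e_(d+2) and t^2 e_(d+3), for the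
    unit vectors e_j.  Row d alone thus contributes e_d in degree 1 and e_(d+1) in
    degree 2, and the four stacked rows are e_d, ..., e_(d+3).  Splitting off the
    diagonal factor displays the powers of t in each row. *)
Definition order2_point : 'M[{poly K}]_(r, s) :=
  diag_mx (\row_i (if (i < d)%N then 1 else if i == d :> nat then 'X else 'X^2)) *m
  \matrix_(i, j)
    (if (i < d)%N then (j == i :> nat)%:R
     else if i == d :> nat then (j == d :> nat)%:R + 'X * (j == d.+1 :> nat)%:R
     else (j == i.+1 :> nat)%:R).

Lemma coef_bool (b : bool) l : (b%:R : {poly K})`_l = (b && (l == 0))%:R.
Proof. by case: b; rewrite ?coef1 ?coef0. Qed.

Lemma size_constant_point i j : (size (constant_point i j) <= 3)%N.
Proof.
apply/leq_sizeP => l l3; rewrite /constant_point mul_diag_mx !mxE -natrM mulnb coef_bool.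
by case: l l3 => // l; rewrite andbF.
Qed.

Lemma size_order2_point i j : (size (order2_point i j) <= 3)%N.
Proof.
apply/leq_sizeP => l l3; rewrite /order2_point mul_diag_mx !mxE.
case: ifP => _; first by rewrite mul1r coef_bool; case: l l3 => // l; rewrite andbF.
case: ifP => _; last by rewrite coefXnM coef_bool; case: l l3 => [|[|[|l]]] // _; rewrite andbF.
rewrite mulrDr mulrA -expr2 coefD coefXM coefXnM !coef_bool.
by case: l l3 => [|[|[|l]]] // _; rewrite !andbF addr0.
Qed.

Lemma minors_constant_point f g : increasing f ->
  \det (mxsub (f : 'I_d.+2 -> 'I_r) (g : 'I_d.+2 -> 'I_s) constant_point) = 0.
Proof.
move=> incf; rewrite det_mxsub_diag_mul (bigD1 ord_max) //=.
by rewrite mxE ltnNge (increasing_ge ord_max incf) !mul0r.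
Qed.

(** The largest two of d + 2 distinct row indices are at least d and d + 1, and the
    corresponding rows carry the factors t (or t^2) and t^2. *)
Lemma minors_order2_point f g : increasing f -> exists u,
  \det (mxsub (f : 'I_d.+2 -> 'I_r) (g : 'I_d.+2 -> 'I_s) order2_point) = 'X^3 * u.
Proof.
move=> incf; rewrite det_mxsub_diag_mul !big_ord_recr /= !mxE.
set a := widen_ord _ ord_max.
have := increasing_ge ord_max incf; have := increasing_ge a incf.
rewrite /= => ha hm.
rewrite [(f ord_max < d)%N]ltnNge (ltnW hm) /= [(f a < d)%N]ltnNge ha /= (gtn_eqF hm).
set P := \prod_(_ < d) _; set E := \det _.
case: ifP => _; first by exists (P * E); ring.
by exists ('X * P * E); ring.
Qed.

Hypotheses (hr : (d.+1 <= r)%N) (hs : (d.+1 <= s)%N).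

Lemma principal_minor_constant_point : principal_minor hr hs constant_point = 1.
Proof.
rewrite /principal_minor (_ : mxsub _ _ _ = 1%:M) ?det1 ?coef1 //.
by apply/matrixP => a b; rewrite mxE /constant_point mul_diag_mx !mxE /= ltn_ord mul1r.
Qed.

(** The matrix is the identity on its first d rows and columns, and the other
    entries of these are zero. *)
Lemma bordered_minor_order2_point (i : 'I_r) (j : 'I_s) : (d <= i)%N -> (d <= j)%N ->
  bordered_minor hr hs order2_point i j = order2_point i j.
Proof.
move=> di dj; rewrite /bordered_minor det_trig.
  rewrite big_ord_recr /= big1 => [|a _]; first by rewrite mul1r [LHS]mxE !border_max.
  by rewrite mxE /order2_point mul_diag_mx !mxE !val_border /= !ltn_ord eqxx mul1r.
apply/is_trig_mxP => a b ab; rewrite mxE /order2_point mul_diag_mx !mxE !val_border.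
have ad : (a < d)%N by have := ltn_ord b; lia.
by rewrite !ad mul1r; case: ifP => bd; rewrite gtn_eqF //; lia.
Qed.

Lemma stacked_minors_order2_point (iota : 'I_4 -> 'I_r) (kappa : 'I_4 -> 'I_s) :
  (forall a, iota a = (d + a.-1)%N :> nat) -> (forall b, kappa b = (d + b)%N :> nat) ->
  stacked_minors hr hs iota kappa order2_point = 1.
Proof.
move=> ei ek; rewrite /stacked_minors (_ : \matrix_(_, _) _ = 1%:M) ?det1 //.
apply/matrixP => a b; rewrite mxE bordered_minor_order2_point ?ei ?ek ?leq_addr //.
rewrite /order2_point mul_diag_mx !mxE ei ek ltnNge leq_addr /=.
have eq0 x : (d + x == d)%N = (x == 0)%N by lia.
have eq1 x : (d + x == d.+1)%N = (x == 1)%N by lia.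
have eqS x y : (d + x == (d + y).+1)%N = (x == y.+1)%N by lia.
rewrite !eq0 eq1 eqS.
case: a => [[|[|[|[|//]]]] la]; case: b => [[|[|[|[|//]]]] lb] //=;
  by rewrite ?mulrDr ?mulrA -?expr2 ?mulr0 ?mulr1 ?addr0 ?add0r ?coefX ?coefXn ?coef0.
Qed.
End Points.

(** Stated for any matrix N of polynomials that specializes to every matrix of
    2-jets, so that it applies to the generic jet and to its transpose. *)
Theorem rank_jets_reducible (R : comNzRingType) (K : idomainType) (r s d : nat)
    (N : 'M[{poly R}]_(r, s)) (Y : prime_idealr R -> Prop) :
  (d.+3 <= r)%N -> (d.+4 <= s)%N ->
  (forall M : 'M[{poly K}]_(r, s), (forall i j, (size (M i j) <= 3)%N) ->
     exists phi : {rmorphism R -> K}, map_mx (map_poly phi) N = M) ->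
  (forall p, Y p <-> minors_in_jet_ideal d.+1 2 N p) ->
  ~ zariski_irreducible Y.
Proof.
move=> hr hs univ YP.
have ltI (a : 'I_4) : (d + a.-1 < r)%N by have := ltn_ord a; lia.
have ltK (a : 'I_4) : (d + a < s)%N by have := ltn_ord a; lia.
have hr1 : (d.+1 <= r)%N by lia.
have hs1 : (d.+1 <= s)%N by lia.
have [phi1 e1] := univ _ (@size_constant_point K r s d).
have [phi2 e2] := univ _ (@size_order2_point K r s d).
apply: (@reducible_by_product R Y
  (stacked_minors hr1 hs1 (fun a => Ordinal (ltI a)) (fun a => Ordinal (ltK a)) N)
  (principal_minor hr1 hs1 N) (kernel phi2) (kernel phi1)).
- by move=> p /YP; apply: stacked_minors_vanish.
- apply/YP/minors_in_kernel => f g incf _; rewrite e2.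
  exact: minors_order2_point.
- rewrite /in_mem /= /kernel rmorph_stacked_minors e2.
  by rewrite stacked_minors_order2_point // oner_eq0.
- apply/YP/minors_in_kernel => f g incf _; rewrite e1.
  by exists 0; rewrite mulr0 minors_constant_point.
- rewrite /in_mem /= /kernel rmorph_principal_minor e1.
  by rewrite principal_minor_constant_point oner_eq0.
Qed.

(** * The determinantal jet scheme *)

Section JetScheme.
Variables (k : fieldType) (r s m : nat).

Lemma jet_matrix_universal (M : 'M[{poly k}]_(r, s)) :
  (forall i j, (size (M i j) <= m.+1)%N) ->
  exists phi : {rmorphism jet_ring k r s m -> k},
    map_mx (map_poly phi) (jet_matrix k r s m) = M.
Proof.
move=> szM.
pose v (q : 'I_#|jet_index r s m|) : k :=
  let: (i, j, l) := (enum_val q : jet_index r s m) in (M i j)`_(l : 'I_m.+1).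
exists (meval v); apply/matrixP => i j; rewrite !mxE rmorph_sum.
rewrite [RHS](_ : _ = \poly_(l < m.+1) (M i j)`_l); last first.
  apply/polyP=> l; rewrite coef_poly; case: ltnP => // lm.
  by rewrite nth_default // (leq_trans (szM i j)).
rewrite poly_def; apply: eq_bigr => l _.
by rewrite rmorphM /= map_polyC map_polyXn /= mevalXU /v enum_rankK mul_polyC.
Qed.

Lemma determinantal_jet_schemeP c (p : prime_idealr (jet_ring k r s m)) :
  @determinantal_jet_scheme k r s c m p <->
  minors_in_jet_ideal c m (jet_matrix k r s m) p.
Proof.
split=> [Yp f g incf incg | minp e [n [a [g [gen ->]]]]].
  apply/jet_idealP => l lm; apply: Yp.
  exists 1, (fun=> 1), (fun=> (\det (mxsub f g (jet_matrix k r s m)))`_l).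
  split=> [_|]; last by rewrite big_ord1 mul1r.
  by exists (\det (mxsub f g (jet_matrix k r s m))), l; split=> //; exists f, g.
apply: rpred_sum => i _; apply: idealMr.
have [d [l [[f [h [incf inch ->]]] lm ->]]] := gen i.
by have /jet_idealP := minp f h incf inch; apply.
Qed.

End JetScheme.

Lemma minors_in_jet_ideal_tr (R : comNzRingType) r s c m
    (N : 'M[{poly R}]_(r, s)) (p : idealr R) :
  minors_in_jet_ideal c m N^T p <-> minors_in_jet_ideal c m N p.
Proof.
by split=> minN f g incf incg; have := minN g f incg incf; rewrite det_mxsub_tr.
Qed.

Theorem theorem4p1 (k : closedFieldType) (char0 : [pchar k] =i pred0)
    (r s c : nat) (hc : (2 <= c)%N) (hr : (c + 2 <= r)%N) (hs : (c + 2 <= s)%N)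
    (hrs : (2 * c + 6 <= r + s)%N) :
  ~ zariski_irreducible (@determinantal_jet_scheme k r s c 2).
Proof.
case: c hc hr hs hrs => [//|d] _ hr hs hrs.
have [hs3|hs3] := leqP d.+4 s.
  apply: (@rank_jets_reducible _ k r s d (jet_matrix k r s 2)) => //; first lia.
    exact: jet_matrix_universal.
  exact: determinantal_jet_schemeP.
apply: (@rank_jets_reducible _ k s r d (jet_matrix k r s 2)^T) => //; try lia.
  move=> M szM; have [|phi e] := @jet_matrix_universal k r s 2 M^T.
    by move=> i j; rewrite mxE.
  by exists phi; rewrite -map_trmx e trmxK.
by move=> p; rewrite minors_in_jet_ideal_tr; apply: determinantal_jet_schemeP.
Qed.
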